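(* Let $d\ge3$, let $V$ be a $d$-dimensional inner product space over a $*$-field $F$ which admits an ON-basis, let $\mathsf L=\mathsf L(V)$ and $\bar\alpha=(1,\dots,1)\in F^d$. Let $\psi(X_1,\dots,X_n)$ be a quantifier free $\Lambda_F$-formula in $d\times d$-matrices $X_k$ of variables which defines an $\bar\alpha$-bi-invariant set $K\subseteq(F^{d\times d})^n$ and which hides coordinate systems. Then $M=\theta_{F\bar\alpha L}(K)\subseteq\mathsf L^n$ can be defined in $\mathsf L$ by a quantifier free $\Lambda_L$-formula $\phi(x_1,\dots,x_n)$.
   Context: A $*$-field $F$ is a (commutative) field with an involution $r\mapsto r^*$ (possibly the identity). An inner product space $V$ over $F$ is a right $F$-vector space of finite dimension $d$ with a form $\langle\cdot|\cdot\rangle$ that is additive in both arguments and satisfies $\langle vr|ws\rangle=r^*\langle v|w\rangle s$, $\langle w|v\rangle=\langle v|w\rangle^*$, is non-degenerate, and has $\langle v|v\rangle\ne0$ for some $v$. Write $|v|=\langle v|v\rangle$. A $\perp$-basis is a basis $\bar v$ with $\langle v_i|v_j\rangle=0$ for $i\ne j$; put $|\bar v|:=(1,|v_1|^{-1}|v_2|,\dots,|v_1|^{-1}|v_d|)$. An ON-basis is a $\perp$-basis with $|\bar v|=(1,\dots,1)$. $\mathsf L(V)$ is the lattice of linear subspaces of $V$ with join $+$, bottom $0$, and involution $U\mapsto U^\perp$. $\Lambda_L$ is the first order language with signature $+,0,{}^\perp$ (with $s\cap t=(s^\perp+t^\perp)^\perp$, $1=0^\perp$); $\Lambda_F$ is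 the language of $*$-rings with constants $0,1$. For a basis $\bar v$ and $A=(a_{ij})\in F^{d\times d}$, $\mathrm{Span}_{\bar v}(A)$ is the span of the vectors $\sum_iv_ia_{ij}$, $j=1,\dots,d$. For $K\subseteq(F^{d\times d})^n$, $\theta_{F\bar\alpha L}(K)$ is the set of all $(\mathrm{Span}_{\bar v}(A_1),\dots,\mathrm{Span}_{\bar v}(A_n))$ with $(A_1,\dots,A_n)\in K$ and $\bar v$ a $\perp$-basis with $|\bar v|=\bar\alpha$. $K$ is $\bar\alpha$-bi-invariant (here $\bar\alpha=(1,\dots,1)$) if $(TA_1T_1,\dots,TA_nT_n)\in K$ for all $(A_1,\dots,A_n)\in K$, all $T_k\in\mathrm{GL}(F,d)$, and all $T\in\mathrm{GL}(F,d)$ with $T^*=rT^{-1}$ for some $0\ne r=r^*\in F$ ($T^*$ the conjugate transpose). An orthonormal frame of $\mathsf L(V)$ is a system $\bar a=(a_{ij}\mid1\le i,j\le d)$ with $a_{ii}=v_iF$ and $a_{ij}=(v_j-v_i)F$ ($i\neq j$) for some ON-basis $\bar v$ of $V$. The formula $\psi$, defining $K$, hides coordinate systems if there are finitely many pairs of tuplets $\bar a^k(\bar x)=(a^k_{ij}(\bar x)\mid 1\le i,j\le d)$ and $\bar t^k(\bar z)=(t^k_1(\bar z),\dots,t^k_n(\bar z))$ of $\Lambda_L$-terms such that, for every $\bar u\in\theta_{F\bar\alpha L}(K)$, there is $k$ such that $\bar a^k(\bar u)$ is an orthonormal frame and $\bar u=\bar t^k(\bar a^k(\bar u))$. *)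

(* Defs.v *)
From HB Require Import structures.
From mathcomp Require Import all_boot all_order all_algebra.

Set Implicit Arguments.
Unset Strict Implicit.
Unset Printing Implicit Defensive.

Import GRing.Theory.
Local Open Scope ring_scope.
Local Open Scope sesquilinear_scope.

Inductive qf (T : Type) : Type :=
  | QEq of T & T
  | QNot of qf T
  | QAnd of qf T & qf T
  | QOr of qf T & qf T.

Fixpoint qf_holds (T A : Type) (ev : T -> A) (f : qf T) : Prop :=
  match f with
  | QEq s t => ev s = ev t
  | QNot g => ~ qf_holds ev g
  | QAnd g h => qf_holds ev g /\ qf_holds ev h
  | QOr g h => qf_holds ev g \/ qf_holds ev h
  end.

(* Lattice terms with variables in X.  Meet and top are the derived terms
   (s^perp + t^perp)^perp and 0^perp, hence are not part of the signature. *)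
Inductive lterm (X : Type) : Type :=
  | LVar of X
  | LZero
  | LJoin of lterm X & lterm X
  | LPerp of lterm X.
Arguments LZero {X}.

(* Terms in the language of *-rings with constants 0 and 1. *)
Inductive fterm (X : Type) : Type :=
  | FVar of X
  | FZero
  | FOne
  | FAdd of fterm X & fterm X
  | FOpp of fterm X
  | FMul of fterm X & fterm X
  | FStar of fterm X.
Arguments FZero {X}.
Arguments FOne {X}.

Section StarField.
Variables (F : fieldType) (star : involutive_rmorphism F).

Fixpoint feval (X : Type) (e : X -> F) (t : fterm X) : F :=
  match t with
  | FVar x => e x
  | FZero => 0
  | FOne => 1
  | FAdd s t => feval e s + feval e t
  | FOpp s => - feval e s
  | FMul s t => feval e s * feval e t
  | FStar s => star (feval e s)
  end.

(* The variable (k, (i, j)) stands for the (i, j) entry of the matrix X_k. *)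
Definition defined_set (n d : nat) (psi : qf (fterm ('I_n * ('I_d * 'I_d))))
    (A : 'I_n -> 'M[F]_d) : Prop :=
  qf_holds (feval (fun x => A x.1 x.2.1 x.2.2)) psi.

(* Bi-invariance with respect to alpha = (1, ..., 1). *)
Definition bi_invariant (n d : nat) (K : ('I_n -> 'M[F]_d) -> Prop) : Prop :=
  forall (A : 'I_n -> 'M[F]_d) (T : 'M[F]_d) (S : 'I_n -> 'M[F]_d) (r : F),
    K A -> (forall k, S k \in unitmx) -> T \in unitmx ->
    r != 0 -> r = star r -> T ^t star = r *: invmx T ->
    K (fun k => T *m A k *m S k).

Section InnerProductSpace.
Variables (V : vectType F) (form : {hermitian V for false & star}).

(* Library forms are linear on the left and star-semilinear on the right,
   whereas < v | w > is star-semilinear in v: the arguments are swapped. *)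
Definition ip (v w : V) : F := form w v.

Lemma ip_scale (v w : V) (r s : F) :
  ip (r *: v) (s *: w) = star r * ip v w * s.
Proof. by rewrite /ip linearZl_LR linearZr_LR /= mulrC. Qed.

Lemma ip_star (v w : V) : ip w v = star (ip v w).
Proof. by rewrite /ip (hermC form v w) expr0 mul1r. Qed.

Definition inner_product : Prop :=
  nondegenerate form /\ exists v : V, ip v v != 0.

Definition perp (U : {vspace V}) : {vspace V} := orthov form U.

Lemma mem_perpP (U : {vspace V}) (w : V) :
  reflect {in U, forall v, ip v w = 0} (w \in perp U).
Proof. exact: mem_orthovP. Qed.

Fixpoint leval (X : Type) (e : X -> {vspace V}) (t : lterm X) : {vspace V} :=
  match t with
  | LVar x => e x
  | LZero => 0%VS
  | LJoin s t => (leval e s + leval e t)%VS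
  | LPerp s => perp (leval e s)
  end.

Definition perp_basis (d : nat) (v : d.-tuple V) : Prop :=
  basis_of fullv v /\ forall i j : 'I_d, i != j -> ip v`_i v`_j = 0.

Definition basis_norm (d : nat) (v : d.-tuple V) : 'rV[F]_d :=
  \row_i (if i == 0%N :> nat then 1 else (ip v`_0 v`_0)^-1 * ip v`_i v`_i).

Definition ON_basis (d : nat) (v : d.-tuple V) : Prop :=
  perp_basis v /\ basis_norm v = const_mx 1.

Definition matrix_span (d : nat) (v : d.-tuple V) (A : 'M[F]_d) : {vspace V} :=
  span [seq \sum_i A i j *: v`_i | j : 'I_d].

Definition theta (n d : nat) (alpha : 'rV[F]_d)
    (K : ('I_n -> 'M[F]_d) -> Prop) (u : 'I_n -> {vspace V}) : Prop :=
  exists (A : 'I_n -> 'M[F]_d) (v : d.-tuple V),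
    [/\ K A, perp_basis v, basis_norm v = alpha
      & forall k, u k = matrix_span v (A k)].

Definition orthonormal_frame (d : nat) (a : 'I_d -> 'I_d -> {vspace V}) : Prop :=
  exists v : d.-tuple V, ON_basis v /\
    forall i j, a i j = if i == j then <[v`_i]>%VS else <[v`_j - v`_i]>%VS.

Definition hides_coordinates (n d : nat)
    (psi : qf (fterm ('I_n * ('I_d * 'I_d)))) : Prop :=
  exists (m : nat) (a : 'I_m -> 'I_d -> 'I_d -> lterm 'I_n)
         (t : 'I_m -> 'I_n -> lterm ('I_d * 'I_d)),
  forall u : 'I_n -> {vspace V},
    theta (const_mx 1 : 'rV[F]_d) (defined_set psi) u ->
    exists k : 'I_m,
      orthonormal_frame (fun i j => leval u (a k i j)) /\
      forall l, u l = leval (fun ij => leval u (a k ij.1 ij.2)) (t k l).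

Definition lattice_definable (n : nat) (M : ('I_n -> {vspace V}) -> Prop) : Prop :=
  exists phi : qf (lterm 'I_n),
    forall u : 'I_n -> {vspace V}, M u <-> qf_holds (leval u) phi.

End InnerProductSpace.
End StarField.

(* Main.v *)
(* M is invariant under the similarities of V, which act transitively on the
   orthonormal frames. Hence, if t^k evaluated at one orthonormal frame gives a
   point of M, it does so at every orthonormal frame. So M is the union, over
   those finitely many k, of the sets defined by "a^k(x) is an orthonormal frame
   and x = t^k(a^k(x))", and being an orthonormal frame is quantifier free
   definable when d >= 3. Which k occur depends on F and V but not on x. *)
Require Import Defs.
From mathcomp Require Import all_boot all_order all_algebra.
From Stdlib Require Import Classical.

Set Implicit Arguments.
Unset Strict Implicit.
Unset Printing Implicit Defensive.

Import GRing.Theory.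
Local Open Scope ring_scope.

(** * Closure properties of terms and of quantifier free definable sets *)

Section Definability.
Variables (F : fieldType) (star : involutive_rmorphism F).
Variables (V : vectType F) (form : {hermitian V for false & star}) (n : nat).

Notation env := ('I_n -> {vspace V}).
Notation definable := (@lattice_definable F star V form n).

Definition term_definable (f : env -> {vspace V}) : Prop :=
  exists t : lterm 'I_n, forall u, f u = leval form u t.

Lemma term_definable0 : term_definable (fun=> 0%VS).
Proof. by exists LZero. Qed.

Lemma term_definable_full : term_definable (fun=> fullv).
Proof. by exists (LPerp LZero) => u /=; rewrite /perp orthov0. Qed.

Lemma term_definableD f g : term_definable f -> term_definable g ->
  term_definable (fun u => f u + g u)%VS.
Proof. by move=> [s hs] [t ht]; exists (LJoin s t) => u /=; rewrite hs ht. Qed.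

Lemma term_definable_perp f : term_definable f ->
  term_definable (fun u => perp form (f u)).
Proof. by move=> [s hs]; exists (LPerp s) => u /=; rewrite hs. Qed.

Lemma term_definable_sum (I : finType) (f : I -> env -> {vspace V}) :
  (forall i, term_definable (f i)) -> term_definable (fun u => \sum_i f i u)%VS.
Proof.
move=> hf; suff [t ht] : exists t : lterm 'I_n, forall u,
    (\sum_(i <- index_enum I) f i u)%VS = leval form u t by exists t.
elim: (index_enum I) => [|i s [t ht]]; first by exists LZero => u; rewrite big_nil.
by have [ti hti] := hf i; exists (LJoin ti t) => u; rewrite big_cons hti ht.
Qed.

Lemma definable_iff P Q : (forall u, P u <-> Q u) -> definable P -> definable Q.
Proof. by move=> PQ [phi hphi]; exists phi => u; rewrite -PQ. Qed.

(** Excluded middle decides [Q] once and for all, so a valid or a contradictory formula serves. This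
    later absorbs a condition on an index that does not mention the point [u]. *)
Lemma definable_const (Q : Prop) : definable (fun=> Q).
Proof.
have [q|nq] := classic Q; first by exists (QEq LZero LZero).
by exists (QNot (QEq LZero LZero)) => u /=; split=> // /(_ erefl).
Qed.

Lemma definable_eq f g : term_definable f -> term_definable g ->
  definable (fun u => f u = g u).
Proof. by move=> [s hs] [t ht]; exists (QEq s t) => u /=; rewrite hs ht. Qed.

Lemma definable_sub f g : term_definable f -> term_definable g ->
  definable (fun u => (f u <= g u)%VS).
Proof.
move=> hf hg; apply: definable_iff (definable_eq (term_definableD hf hg) hg).
by move=> u; split=> [/addv_idPr|/addv_idPr].
Qed.

Lemma definable_not P : definable P -> definable (fun u => ~ P u).
Proof. by move=> [phi hphi]; exists (QNot phi) => u /=; rewrite hphi. Qed.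

Lemma definable_and P Q : definable P -> definable Q ->
  definable (fun u => P u /\ Q u).
Proof.
by move=> [p hp] [q hq]; exists (QAnd p q) => u /=; rewrite hp hq.
Qed.

Lemma definable_or P Q : definable P -> definable Q ->
  definable (fun u => P u \/ Q u).
Proof.
by move=> [p hp] [q hq]; exists (QOr p q) => u /=; rewrite hp hq.
Qed.

(** The guard [b] does not depend on [u]. It stands for comparisons of indices such as [i != j] in
    the frame axioms. *)
Lemma definable_if (b : bool) P : definable P -> definable (fun u => b -> P u).
Proof.
case: b => hP; first by apply: definable_iff hP => u; split=> // /(_ isT).
by apply: definable_iff (definable_const True).
Qed.

Lemma definable_forall (I : finType) (P : I -> env -> Prop) :
  (forall i, definable (P i)) -> definable (fun u => forall i, P i u).
Proof.
move=> hP.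
suff: definable (fun u => forall i, i \in enum I -> P i u).
  by apply: definable_iff => u; split=> h i; [apply: h; rewrite mem_enum|].
elim: (enum I) => [|i s IHs]; first by apply: definable_iff (definable_const True).
apply: definable_iff (definable_and (hP i) IHs) => u; split.
  by move=> [Pi Ps] j; rewrite inE => /orP[/eqP->//|/Ps].
by move=> h; split=> [|j js]; apply: h; rewrite inE ?eqxx ?js ?orbT.
Qed.

Lemma definable_exists (I : finType) (P : I -> env -> Prop) :
  (forall i, definable (P i)) -> definable (fun u => exists i, P i u).
Proof.
move=> hP.
suff: definable (fun u => exists2 i, i \in enum I & P i u).
  by apply: definable_iff => u; split=> [[i _ ?]|[i ?]]; exists i; rewrite ?mem_enum.
elim: (enum I) => [|i s IHs].
  by apply: definable_iff (definable_const False) => u; split=> // -[].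
apply: definable_iff (definable_or (hP i) IHs) => u; split.
  move=> [Pi|[j js Pj]]; first by exists i; rewrite ?inE ?eqxx.
  by exists j; rewrite // inE js orbT.
by move=> [j]; rewrite inE => /orP[/eqP->|js] Pj; [left|right; exists j].
Qed.

End Definability.

(** * Calculus of the form and of orthogonal subspaces *)

Section InnerProduct.
Variables (F : fieldType) (star : involutive_rmorphism F).
Variables (V : vectType F) (form : {hermitian V for false & star}).

Notation ip := (ip form).
Notation perp := (perp form).

Lemma ipDr x y z : ip x (y + z) = ip x y + ip x z.
Proof. by rewrite /Defs.ip linearDl. Qed.

Lemma ipDl x y z : ip (x + y) z = ip x z + ip y z.
Proof. by rewrite /Defs.ip linearDr. Qed.

Lemma ipZr a x y : ip x (a *: y) = a * ip x y.
Proof. by rewrite /Defs.ip linearZl_LR. Qed.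

Lemma ipZl a x y : ip (a *: x) y = star a * ip x y.
Proof. by rewrite /Defs.ip linearZr_LR. Qed.

Lemma ipNr x y : ip x (- y) = - ip x y.
Proof. by rewrite -scaleN1r ipZr mulN1r. Qed.

Lemma ipNl x y : ip (- x) y = - ip x y.
Proof. by rewrite -scaleN1r ipZl rmorphN1 mulN1r. Qed.

Lemma ip0r x : ip x 0 = 0.
Proof. by rewrite -(scale0r 0) ipZr mul0r. Qed.

Lemma ip0l x : ip 0 x = 0.
Proof. by rewrite -(scale0r 0) ipZl rmorph0 mul0r. Qed.

Lemma ip_sumr (I : finType) x (y : I -> V) :
  ip x (\sum_i y i) = \sum_i ip x (y i).
Proof. by elim/big_ind2: _ => [|a b c e <- <-|//]; rewrite ?ip0r ?ipDr. Qed.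

Lemma ip_suml (I : finType) (x : I -> V) y :
  ip (\sum_i x i) y = \sum_i ip (x i) y.
Proof. by elim/big_ind2: _ => [|a b c e <- <-|//]; rewrite ?ip0l ?ipDl. Qed.

Lemma ip_eq0C x y : ip x y = 0 -> ip y x = 0.
Proof. by move=> h; rewrite (ip_star form x y) h rmorph0. Qed.

Lemma mem_perpD_lines x p q :
  ip p x = 0 -> ip q x = 0 -> x \in perp (<[p]> + <[q]>)%VS.
Proof.
move=> px qx; apply/mem_perpP => _ /memv_addP[_ /vlineP[k ->] [_ /vlineP[l ->] ->]].
by rewrite ipDl !ipZl px qx !mulr0 addr0.
Qed.

Lemma sub_perpP (U W : {vspace V}) :
  reflect {in U & W, forall x y, ip x y = 0} (U <= perp W)%VS.
Proof.
apply: (iffP subvP) => h x => [y xU yW|xU].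
  by apply: ip_eq0C; have /mem_perpP := h x xU; apply.
by apply/mem_perpP => y yW; apply/ip_eq0C/h.
Qed.

Lemma nondegenerate_eq0 x : nondegenerate form -> (forall y, ip x y = 0) -> x = 0.
Proof.
move=> /eqP nd hx; apply/eqP; rewrite -memv0 -nd; apply/mem_perpP => y _.
exact/ip_eq0C/hx.
Qed.

(** As an element of [U], [x] is orthogonal to [W]; as an element of [W], it is orthogonal to [U].
    So it lies in the radical. This replaces the rule that a subspace meets its orthogonal only in
    0, which fails when there are isotropic vectors. *)
Lemma perp_supplement_eq0 (U W : {vspace V}) x : nondegenerate form ->
  (U <= perp W)%VS -> (U + W = fullv)%VS -> x \in U -> x \in W -> x = 0.
Proof.
move=> nd /sub_perpP UW UWfull xU xW; apply: nondegenerate_eq0 => // y.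
have /memv_addP[p pU [q qW ->]] : y \in (U + W)%VS by rewrite UWfull memvf.
by rewrite ipDr (UW x q) // addr0; apply/ip_eq0C/UW.
Qed.

Lemma sub_vline_eq (U : {vspace V}) v : U <> 0%VS -> (U <= <[v]>)%VS -> U = <[v]>%VS.
Proof.
move=> /eqP U0 Uv; apply/eqP; rewrite eqEdim Uv dim_vline.
by apply: leq_trans (leq_b1 _) _; rewrite lt0n dimv_eq0.
Qed.

(** * Orthogonal bases, and a lattice description of orthonormal frames *)

Section Bases.
Variable d : nat.
Implicit Types v w : d.-tuple V.

(** An isotropic member of a perp-basis would be orthogonal to the whole basis, hence to all of
    V. *)
Lemma perp_basis_norm_neq0 v (i : 'I_d) : nondegenerate form -> perp_basis form v ->
  ip v`_i v`_i != 0.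
Proof.
move=> nd [vB vperp]; apply/eqP => vi0.
have vi : v`_i \in val v by rewrite mem_nth ?size_tuple.
suff /eqP : v`_i = 0 by rewrite (negPf (basis_not0 vB vi)).
apply: nondegenerate_eq0 => // y; rewrite (coord_basis vB (memvf y)) ip_sumr.
apply: big1 => j _; rewrite ipZr; have [<-|ij] := eqVneq i j; first by rewrite vi0 mulr0.
by rewrite vperp // mulr0.
Qed.

(** Removes the special role of index 0 in [basis_norm]; the division there is harmless because
    basis vectors have nonzero norm. The common norm need not be 1. *)
Lemma ON_basisP v : nondegenerate form ->
  ON_basis form v <->
  perp_basis form v /\ forall i j : 'I_d, ip v`_i v`_i = ip v`_j v`_j.
Proof.
move=> nd; rewrite /ON_basis.
split=> -[pv hv]; split=> //; last first.
  apply/rowP => i; rewrite !mxE; case: ifP => // _.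
  have d0 : (0 < d)%N := leq_trans (ltn0Sn i) (ltn_ord i).
  by rewrite (hv i (Ordinal d0)) /= mulVf // (perp_basis_norm_neq0 (Ordinal d0)).
suff eq0 (i : 'I_d) : ip v`_i v`_i = ip v`_0 v`_0 by move=> i j; rewrite !eq0.
have d0 : (0 < d)%N := leq_trans (ltn0Sn i) (ltn_ord i).
have /rowP/(_ i) := hv; rewrite !mxE; case: eqP => [->//|_ h].
have v0 := perp_basis_norm_neq0 (Ordinal d0) nd pv.
by rewrite -[RHS]mulr1 -h mulrA mulfV // mul1r.
Qed.

Lemma ip_ON v (o : 'I_d) (x y : 'I_d -> F) : nondegenerate form -> ON_basis form v ->
  ip (\sum_i x i *: v`_i) (\sum_i y i *: v`_i) =
  (\sum_i star (x i) * y i) * ip v`_o v`_o.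
Proof.
move=> nd /(ON_basisP _ nd)[[_ vperp] veq].
rewrite ip_suml mulr_suml; apply: eq_bigr => i _.
rewrite ip_sumr (bigD1 i) //= big1 ?addr0 => [|j ji].
  by rewrite ip_scale mulrAC (veq i o).
by rewrite ip_scale vperp 1?eq_sym // mulr0 mul0r.
Qed.

(* Orthogonal nonzero subspaces spanning V are lines as soon as there are dim V
   of them, even if the form has isotropic vectors. *)
Lemma orthogonal_lines (a : 'I_d -> {vspace V}) v :
  nondegenerate form -> \dim {:V} = d ->
  (forall i j, i != j -> (a i <= perp (a j))%VS) -> (\sum_i a i)%VS = fullv ->
  (forall i : 'I_d, v`_i \in a i /\ v`_i != 0) ->
  perp_basis form v /\ forall i, a i = <[v`_i]>%VS.
Proof.
move=> nd dimV aperp afull va.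
(* The sum of the other subspaces is orthogonal to [a i] and together with it spans V, so the two
   meet in 0. *)
have inter0 i x : x \in a i -> x \in (\sum_(j | j != i) a j)%VS -> x = 0.
  apply: perp_supplement_eq0 => //; last by rewrite -afull [RHS](bigD1 i).
  apply/sub_perpP => y z yi /memv_sumP[w wj ->].
  rewrite big_mkcond /= ip_sumr big1 // => j _; case: ifP => ji; last by rewrite ip0r.
  by rewrite eq_sym in ji; have /sub_perpP := aperp i j ji; apply=> //; apply: wj; rewrite eq_sym.
have freev : free v.
  apply/freeP => k k0 i; have [vi vi0] := va i.
  suff /eqP : k i *: v`_i = 0 by rewrite scaler_eq0 (negPf vi0) orbF => /eqP.
  apply: (inter0 i); first exact: memvZ.
  move: k0; rewrite (bigD1 i) //= => /eqP; rewrite addr_eq0 => /eqP ->.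
  rewrite memvN; apply: memv_sumr => j _; apply/memvZ; exact: (va j).1.
have basv : basis_of fullv v.
  by rewrite basisEfree freev subvf size_tuple dimV leqnn.
split=> [|i]; first split=> // i j ij.
  by have /sub_perpP := aperp i j ij; apply; [exact: (va i).1|exact: (va j).1].
apply/eqP; rewrite eqEsubv -memvE (va i).1 andbT; apply/subvP => x xi.
have xE := coord_basis basv (memvf x).
(* Removing the i-th component of [x] leaves a vector both in [a i] and in the sum of the other
   subspaces. *)
have x0 : x - coord v i x *: v`_i = 0.
  apply: (inter0 i); first by rewrite memvB // memvZ // (va i).1.
  rewrite {1}xE (bigD1 i) //= addrAC subrr add0r.
  by apply: memv_sumr => j _; apply/memvZ; exact: (va j).1.
by move/eqP: x0; rewrite subr_eq0 => /eqP ->; rewrite memvZ ?memv_line.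
Qed.


(** Elements of [a] are combinations of [p] and [q], and [a] contains no nonzero multiple of either;
    so [a] is a line on which both coefficients are nonzero, and rescaling [q] normalizes its
    generator. This is how frame vectors get adjusted to each other. *)
Lemma perspectivity_axis (p q : V) (a : {vspace V}) :
  (a <= <[p]> + <[q]>)%VS -> a <> 0%VS ->
  ~ (<[p]> <= a)%VS -> ~ (<[q]> <= a)%VS ->
  exists w : V, [/\ w \in <[q]>%VS, w != 0 & a = <[w - p]>%VS].
Proof.
rewrite -!memvE => /subvP apq /eqP a0 pa qa.
have aE x : x \in a -> exists al be, x = al *: p + be *: q.
  by move=> /apq /memv_addP[_ /vlineP[al ->] [_ /vlineP[be ->] ->]]; exists al, be.
have scaled_q be : be *: q \in a -> be = 0.
  move=> h; apply/eqP; apply/idPn => be0; apply: qa.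
  by rewrite -[q](scalerK be0) memvZ.
have x0 : vpick a != 0 by rewrite vpick0.
have [al [be xE]] := aE _ (memv_pick a); have xa := memv_pick a.
move: x0 xa; rewrite xE => x0 xa.
have al0 : al != 0.
  apply: contraNneq x0 => al0; move: xa; rewrite al0 scale0r add0r => /scaled_q ->.
  by rewrite scale0r.
have be0 : be != 0.
  apply/eqP => be0; apply: pa; move: xa; rewrite be0 scale0r addr0 => xa.
  by rewrite -[p](scalerK al0) memvZ.
have q0 : q != 0 by apply/eqP => q0; apply: qa; rewrite q0 mem0v.
(* The multiple of [q] for which [w - p] is proportional to the picked vector of [a]. *)
pose w := (- (al^-1 * be)) *: q.
have wE : w - p = - al^-1 *: (al *: p + be *: q).
  by rewrite /w scalerDr !scalerA !mulNr mulVf // scaleN1r addrC.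
exists w; split; first by rewrite memvZ ?memv_line.
  by rewrite scaler_eq0 negb_or oppr_eq0 mulf_neq0 ?invr_eq0.
apply: sub_vline_eq; first exact/eqP.
apply/subvP => y ya; have [ga [de yE]] := aE _ ya.
apply/vlineP; exists (- ga).
(* Cancelling the [p]-part of [y] against the picked vector leaves a multiple of [q] in [a], which
   must vanish. *)
suff /scaled_q de0 : (de - ga * al^-1 * be) *: q \in a.
  rewrite yE wE scalerA mulrNN scalerDr !scalerA divfK //.
  by move/eqP: de0; rewrite subr_eq0 => /eqP ->.
have -> : (de - ga * al^-1 * be) *: q = y - (ga * al^-1) *: (al *: p + be *: q).
  by rewrite yE scalerDr !scalerA divfK // scalerBl opprD addrACA subrr add0r.
by rewrite memvB // memvZ.
Qed.

(** Compare coordinates at [o]: the first plane has none, while in the second it is minus the sum of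
    the two coefficients. These are therefore opposite, and [v_o] cancels. *)
Lemma third_axis v (o i j : 'I_d) (a : {vspace V}) : free v ->
  i != o -> j != o -> a <> 0%VS ->
  (a <= <[v`_i]> + <[v`_j]>)%VS -> (a <= <[v`_i - v`_o]> + <[v`_j - v`_o]>)%VS ->
  a = <[v`_j - v`_i]>%VS.
Proof.
move=> freev io jo a0 /subvP aij /subvP aoij.
apply: sub_vline_eq => //; apply/subvP => x xa.
have /memv_addP[_ /vlineP[al ->] [_ /vlineP[be ->] xE]] := aij x xa.
have /memv_addP[_ /vlineP[ga ->] [_ /vlineP[de ->] xE']] := aoij x xa.
have gade : - ga = de.
  have /eqP := congr1 (coord v o) (etrans (esym xE) xE').
  rewrite !linearD /= !linearZ /= !linearN /= !coord_free //.
  rewrite (negPf io) (negPf jo) eqxx !mulr0 !add0r !mulrN1.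
  by rewrite eq_sym subr_eq0 => /eqP.
apply/vlineP; exists de.
by rewrite xE' -gade !scaleNr -[RHS]scalerN -scalerBr !opprB addrA subrK.
Qed.

(* The last axiom: [v_o + v_j - v_k] spans the meet of [v_o F + (v_k - v_j) F] and
   [(v_k - v_o) F + v_j F], and it is orthogonal to [v_j - v_o] if and only if
   [v_o] and [v_j] have the same norm. *)
Definition frame_axioms (o : 'I_d) (a : 'I_d -> 'I_d -> {vspace V}) : Prop :=
  (forall i, a i i <> 0%VS) /\
  (forall i j, i != j -> (a i i <= perp (a j j))%VS) /\
  (\sum_i a i i)%VS = fullv /\
  (forall j, j != o ->
     (a o j <= a o o + a j j)%VS /\ a o j <> 0%VS /\
     ~ (a o o <= a o j)%VS /\ ~ (a j j <= a o j)%VS) /\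
  (forall i, i != o -> a i o = a o i) /\
  (forall i j, i != o -> j != o -> i != j ->
     a i j <> 0%VS /\ (a i j <= a i i + a j j)%VS /\ (a i j <= a o i + a o j)%VS) /\
  (forall j k, j != o -> k != o -> k != j ->
     (a o j <= perp (a o k + a j j) + perp (a j k + a o o))%VS).

Lemma vline_sub_sym (x y : V) : <[x - y]>%VS = <[y - x]>%VS.
Proof.
by apply/eqP; rewrite eqEsubv -!memvE; apply/andP; split; rewrite -memvN opprB memv_line.
Qed.

Lemma orthonormal_frame_axioms (o : 'I_d) (a : 'I_d -> 'I_d -> {vspace V}) :
  nondegenerate form -> orthonormal_frame form a -> frame_axioms o a.
Proof.
move=> nd [v [/(ON_basisP _ nd)[[vB vperp] veq] aE]].
have freev := basis_free vB.
have a_diag i : a i i = <[v`_i]>%VS by rewrite aE eqxx.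
have a_off i j : i != j -> a i j = <[v`_j - v`_i]>%VS by rewrite aE => /negPf->.
have v0 (i : 'I_d) : v`_i != 0 by rewrite (basis_not0 vB) ?mem_nth ?size_tuple.
have nmem (c : 'I_d) (x y : V) : x != 0 -> coord v c x = 0 -> coord v c y != 0 ->
    ~ (<[x]> <= <[y]>)%VS.
  move=> x0 xc yc; rewrite -memvE => /vlineP[k xE]; move: xc; rewrite xE linearZ /=.
  by move=> /eqP; rewrite mulf_eq0 (negPf yc) orbF => k0; rewrite xE (eqP k0) scale0r eqxx in x0.
have coordvB (c i j : 'I_d) : coord v c (v`_j - v`_i) = (j == c)%:R - (i == c)%:R.
  by rewrite linearB /= !coord_free.
have nzB (i j : 'I_d) : i != j -> v`_j - v`_i != 0.
  move=> ij; apply/eqP => /(congr1 (coord v j)); rewrite coordvB linear0.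
  by rewrite eqxx (negPf ij) subr0 => /eqP; rewrite oner_eq0.
have line0 (x : V) : x != 0 -> <[x]>%VS <> 0%VS.
  by move=> x0 /eqP; rewrite -dimv_eq0 dim_vline x0.
split=> [i|]; first by rewrite a_diag; apply: line0.
split=> [i j ij|].
  rewrite !a_diag; apply/sub_perpP => _ _ /vlineP[k ->] /vlineP[l ->].
  by rewrite ip_scale vperp // mulr0 mul0r.
split.
  rewrite -(span_basis vB) span_def big_tuple.
  by apply: eq_bigr => i _; rewrite a_diag (tnth_nth 0).
split=> [j jo|].
  have oj : o != j by rewrite eq_sym.
  rewrite !a_diag a_off //; split; first by rewrite -memvE addrC memv_add ?memvN ?memv_line.
  split; first exact/line0/nzB.
  split; [apply: (nmem j)|apply: (nmem o)] => //; rewrite ?coord_free ?coordvB ?eqxx //.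
  - by rewrite (negPf oj).
  - by rewrite (negPf oj) subr0 oner_eq0.
  - by rewrite (negPf jo).
  - by rewrite (negPf jo) sub0r oppr_eq0 oner_eq0.
split=> [i io|]; first by rewrite !a_off // 1?eq_sym // vline_sub_sym.
split=> [i j io jo ij|j k jo ko kj].
  rewrite !a_diag !a_off // 1?eq_sym //; split; first exact/line0/nzB.
  split; rewrite -memvE; first by rewrite addrC memv_add ?memvN ?memv_line.
  have -> : v`_j - v`_i = - (v`_i - v`_o) + (v`_j - v`_o) by rewrite opprB [RHS]addrC addrA subrK.
  by rewrite memv_add ?memvN ?memv_line.
rewrite !a_diag !a_off // 1?eq_sym // -memvE.
(* Equality of norms makes [v_o + v_k] orthogonal to [v_k - v_o], and [v_j + v_k] orthogonal to
   [v_k - v_j]; so each summand lies in one of the two orthogonals. *)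
have -> : v`_j - v`_o = - (v`_o + v`_k) + (v`_j + v`_k).
  by rewrite opprD addrACA [- v`_o + _]addrC addNr addr0.
have vp (p q : 'I_d) : p != q -> ip v`_p v`_q = 0 := vperp p q.
have oj : o != j by rewrite eq_sym.
have ok : o != k by rewrite eq_sym.
have jk : j != k by rewrite eq_sym.
have vE := (vp _ _ oj, vp _ _ ok, vp _ _ jk, vp _ _ jo, vp _ _ ko, vp _ _ kj).
apply: memv_add; rewrite ?memvN; apply: mem_perpD_lines;
  rewrite ?ipDr ?ipDl ?ipNl !vE ?(veq k o) ?(veq j o);
  by rewrite !(oppr0, addr0, add0r) ?addNr ?subrr.
Qed.

(** The diagonal determines a perp-basis up to scalars, the lines [a o j] fix the scalars relative
    to the vector at [o], and the last axiom then forces equal norms. *)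
Lemma frame_axioms_orthonormal (o : 'I_d) (a : 'I_d -> 'I_d -> {vspace V}) :
  nondegenerate form -> \dim {:V} = d -> (3 <= d)%N ->
  frame_axioms o a -> orthonormal_frame form a.
Proof.
move=> nd dimV d3 [a0 [aperp [afull [axis [axis_sym [axis3 norm_axis]]]]]].
pose u := [tuple vpick (a i i) | i < d].
have uE (i : 'I_d) : u`_i = vpick (a i i) by rewrite -tnth_nth tnth_mktuple.
have u_in (i : 'I_d) : u`_i \in a i i /\ u`_i != 0.
  by rewrite uE memv_pick vpick0; split=> //; apply/eqP.
have [_ a_line] := orthogonal_lines nd dimV aperp afull u_in.
(* [u_o] stays as the reference vector; every other vector is rescaled inside [a j j] so that its
   difference from [u_o] spans [a o j]. *)
have /fin_all_exists[w wP] (j : 'I_d) : exists w : V,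
    [/\ w \in a j j, w != 0, j == o -> w = u`_o
      & j != o -> a o j = <[w - u`_o]>%VS].
  have [->|jo] := eqVneq j o; first by exists u`_o; have [] := u_in o.
  have [sub [nz [no nj]]] := axis j jo.
  rewrite !a_line in sub no nj.
  have [w [w_in w0 aw]] := perspectivity_axis sub nz no nj.
  by exists w; rewrite (a_line j).
pose v := [tuple w i | i < d].
have vE (i : 'I_d) : v`_i = w i by rewrite -tnth_nth tnth_mktuple.
have v_in (i : 'I_d) : v`_i \in a i i /\ v`_i != 0 by rewrite vE; have [] := wP i.
have [pv a_diag] := orthogonal_lines nd dimV aperp afull v_in.
have [vB vperp] := pv; have freev := basis_free vB.
have vo : v`_o = u`_o by rewrite vE; have [_ _ ->] := wP o.
have a_axis j : j != o -> a o j = <[v`_j - v`_o]>%VS.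
  by move=> jo; have [_ _ _] := wP j; rewrite vo vE; apply.
have a_off i j : i != j -> a i j = <[v`_j - v`_i]>%VS.
  have [->|io] := eqVneq i o; first by rewrite eq_sym => /a_axis.
  have [->|jo] := eqVneq j o; first by rewrite axis_sym // a_axis // vline_sub_sym.
  move=> ij; have [nz [sub suba]] := axis3 i j io jo ij.
  by apply: (third_axis freev io jo nz); rewrite -?a_diag -?a_axis.
exists v; split; last first.
  by move=> i j; have [->|/a_off] := eqVneq i j; first exact: a_diag.
apply/(ON_basisP _ nd); split=> //.
suff norm_eq (j : 'I_d) : ip v`_j v`_j = ip v`_o v`_o by move=> i j; rewrite !norm_eq.
have [->//|jo] := eqVneq j o.
(* Here [d >= 3] enters: the norm axiom compares [o] and [j] through a third index. *)
have [k /andP[ko kj]] : exists k : 'I_d, (k != o) && (k != j).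
  apply/existsP; apply: contraTT d3 => /existsPn h; rewrite -ltnNge ltnS.
  have -> : d = #|[set o; j]|.
    rewrite -[LHS]card_ord; apply: eq_card => k; rewrite !inE.
    by have := h k; rewrite negb_and !negbK => ->.
  by rewrite cards2 ltnS leq_b1.
have /memv_addP[x xP [y yP xyE]] : v`_j - v`_o \in
    (perp (a o k + a j j) + perp (a j k + a o o))%VS.
  by apply: (subvP (norm_axis j k jo ko kj)); rewrite a_axis // memv_line.
(* [p] lies in both sums whose orthogonals contain [x] and [y], so it is orthogonal to [v_j - v_o];
   expanding this product gives the equality of norms. *)
pose p := v`_o + v`_j - v`_k.
have px : ip p x = 0.
  move/mem_perpP: xP; apply; rewrite a_axis // a_diag.
  have -> : p = - (v`_k - v`_o) + v`_j by rewrite opprB /p addrAC.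
  by rewrite memv_add ?memvN ?memv_line.
have py : ip p y = 0.
  move/mem_perpP: yP; apply; rewrite a_off 1?eq_sym // a_diag.
  have -> : p = - (v`_k - v`_j) + v`_o by rewrite opprB [RHS]addrC /p addrA.
  by rewrite memv_add ?memvN ?memv_line.
have vp (q r : 'I_d) : q != r -> ip v`_q v`_r = 0 := vperp q r.
have : ip p (v`_j - v`_o) = 0 by rewrite xyE ipDr px py addr0.
have oj : o != j by rewrite eq_sym.
rewrite /p ipDr ipNr !ipDl !ipNl (vp _ _ oj) (vp _ _ jo) (vp _ _ ko) (vp _ _ kj).
rewrite !(oppr0, addr0, add0r).
by move=> /eqP; rewrite subr_eq0 => /eqP.
Qed.

(** The linear map sending [v] to [w] works: in coordinates both forms are the same sum times the
    common norm of the basis, so [c] is the ratio of these norms. *)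
Lemma similarity_of_ON_bases (o : 'I_d) v w : nondegenerate form ->
  ON_basis form v -> ON_basis form w ->
  exists (g : 'End(V)) (c : F), [/\ lker g == 0%VS, c != 0,
    forall x y, ip (g x) (g y) = c * ip x y & map g v = w].
Proof.
move=> nd vON wON; have [[vB _] _] := vON; have [[wB _] _] := wON.
have [f fE] := linear_of_free v w.
have gvw : map (linfun f) v = w.
  rewrite -[RHS]fE ?(basis_free vB) ?size_tuple //.
  by apply: eq_map => x; rewrite lfunE.
have gi (i : 'I_d) : linfun f v`_i = w`_i.
  by rewrite -gvw (nth_map 0) ?size_tuple.
have g_full : limg (linfun f) = fullv.
  by rewrite -[RHS](span_basis wB) -gvw -limg_span (span_basis vB).
have vo := perp_basis_norm_neq0 o nd vON.1.
have wo := perp_basis_norm_neq0 o nd wON.1.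
exists (linfun f), (ip w`_o w`_o / ip v`_o v`_o); split=> //.
(* Surjectivity gives a trivial kernel by rank-nullity. *)
- have := limg_ker_dim (linfun f) fullv; rewrite g_full capfv => /eqP.
  by rewrite -[X in _ == X]add0n eqn_add2r dimv_eq0.
- by rewrite mulf_neq0 ?invr_eq0.
move=> x y; rewrite (coord_basis vB (memvf x)) (coord_basis vB (memvf y)).
rewrite (ip_ON o _ _ nd vON) !linear_sum /=.
under eq_bigr do rewrite linearZ /= gi.
under [X in ip _ X]eq_bigr do rewrite linearZ /= gi.
by rewrite (ip_ON o _ _ nd wON) mulrCA divfK // mulrC.
Qed.

End Bases.

(** * Action of a similarity on subspaces, terms and [theta] *)

Section Similarity.
Variables (g : 'End(V)) (c : F).
Hypotheses (g_inj : lker g == 0%VS) (c0 : c != 0).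
Hypothesis g_sim : forall x y, ip (g x) (g y) = c * ip x y.

(** As [c] is nonzero, [g] preserves and reflects orthogonality, and an injective endomorphism is
    onto. Hence [g] induces an automorphism of the lattice with involution. *)
Lemma limg_perp (U : {vspace V}) : (g @: perp U)%VS = perp (g @: U).
Proof.
apply/vspaceP => y; apply/memv_imgP/mem_perpP => [[x xU ->] _ /memv_imgP[z zU ->]|h].
  by rewrite g_sim; move/mem_perpP: xU => ->; rewrite ?mulr0.
have /memv_imgP[x _ yE] : y \in limg g by rewrite lker0_limgf ?memvf.
exists x => //; apply/mem_perpP => z zU.
by have /eqP := h _ (memv_img g zU); rewrite yE g_sim mulf_eq0 (negPf c0) => /eqP.
Qed.

Lemma limg_leval (X : Type) (e e' : X -> {vspace V}) (t : lterm X) :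
  (forall x, e' x = (g @: e x)%VS) -> leval form e' t = (g @: leval form e t)%VS.
Proof.
move=> eE; elim: t => [x||s IHs t IHt|t IHt] /=; rewrite ?limg0 //.
  by rewrite limgD IHs IHt.
by rewrite limg_perp IHt.
Qed.

Lemma limg_matrix_span d (v : d.-tuple V) (A : 'M[F]_d) :
  (g @: matrix_span v A)%VS = matrix_span [tuple of map g v] A.
Proof.
rewrite /matrix_span limg_span -map_comp; congr span; apply: eq_map => j /=.
rewrite linear_sum; apply: eq_bigr => i _.
by rewrite linearZ /= (nth_map 0) ?size_tuple.
Qed.

Lemma limg_perp_basis d (v : d.-tuple V) :
  perp_basis form v -> perp_basis form [tuple of map g v].
Proof.
move=> [vB vperp]; split=> [|i j ij]; last first.
  by rewrite !(nth_map 0) ?size_tuple // g_sim vperp ?mulr0.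
rewrite -(lker0_limgf g_inj); apply: limg_basis_of => //.
by rewrite (eqP g_inj) capv0.
Qed.

(** The same matrices serve with the image basis, which is again an ON-basis because all its norms
    are multiplied by the same [c]. *)
Lemma limg_theta d n (K : ('I_n -> 'M[F]_d) -> Prop) (u u' : 'I_n -> {vspace V}) :
  nondegenerate form -> (forall l, u' l = (g @: u l)%VS) ->
  theta form (const_mx 1) K u -> theta form (const_mx 1) K u'.
Proof.
move=> nd uE [A [v [KA pv vn uA]]].
have [_ veq] := (ON_basisP _ nd).1 (conj pv vn).
have : ON_basis form [tuple of map g v].
  apply/(ON_basisP _ nd); split=> [|i j]; first exact: limg_perp_basis.
  by rewrite !(nth_map 0) ?size_tuple // !g_sim (veq i j).
move=> [pgv gvn]; exists A, [tuple of map g v]; split=> // l.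
by rewrite uE uA limg_matrix_span.
Qed.

End Similarity.
End InnerProduct.

(** * Definability of orthonormal frames and of [theta] *)

Lemma definable_orthonormal_frame (F : fieldType) (star : involutive_rmorphism F)
    (V : vectType F) (form : {hermitian V for false & star}) (d n : nat)
    (a : 'I_d -> 'I_d -> ('I_n -> {vspace V}) -> {vspace V}) :
  nondegenerate form -> \dim {:V} = d -> (3 <= d)%N ->
  (forall i j, term_definable form (a i j)) ->
  lattice_definable form (fun u => orthonormal_frame form (fun i j => a i j u)).
Proof.
move=> nd dimV d3 aD; pose o : 'I_d := Ordinal (leq_trans (isT : 0 < 3)%N d3).
apply: (@definable_iff _ _ _ _ _ (fun u => frame_axioms form o (fun i j => a i j u))).
  move=> u; split; first exact: frame_axioms_orthonormal.
  exact: orthonormal_frame_axioms.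
(* With the quantifier over bases gone, only finite index ranges, Boolean connectives and
   (in)equalities between terms remain. *)
repeat first [exact: aD | apply: definable_and | apply: definable_forall => ?
  | apply: definable_if | apply: definable_not | apply: definable_sub
  | apply: definable_eq | exact: term_definable0 | exact: term_definable_full
  | apply: term_definable_perp | apply: term_definableD
  | apply: term_definable_sum => ?].
Qed.

Theorem proposition24 (F : fieldType) (star : involutive_rmorphism F)
    (V : vectType F) (form : {hermitian V for false & star})
    (d n : nat) (psi : qf (fterm ('I_n * ('I_d * 'I_d)))) :
  (3 <= d)%N -> \dim {:V} = d -> inner_product form ->
  (exists v : d.-tuple V, ON_basis form v) ->
  bi_invariant star (defined_set star psi) ->
  hides_coordinates form psi ->
  lattice_definable form
    (theta form (const_mx 1 : 'rV[F]_d) (defined_set star psi)).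
Proof.
move=> d3 dimV [nd _] _ _ [m [a [t hide]]].
set M := theta _ _ _.
pose o : 'I_d := Ordinal (leq_trans (isT : 0 < 3)%N d3).
pose hid k (u : 'I_n -> {vspace V}) :=
  orthonormal_frame form (fun i j => leval form u (a k i j)) /\
  forall l, u l = leval form (fun ij => leval form u (a k ij.1 ij.2)) (t k l).
(* The inner existential does not involve [u]: it only selects the indices [k] that occur at some
   point of [M]. *)
apply: (@definable_iff _ _ _ _ _ (fun u => exists k, (exists u0, M u0 /\ hid k u0) /\ hid k u)).
  move=> u; split=> [[k [[u0 [Mu0 [[v0 [v0ON f0]] u0E]]] [[v [vON f]] uE]]]|Mu]; last first.
    by have [k hk] := hide u Mu; exists k; split=> //; exists u.
  (* [g] carries the frame of [u0] to that of [u]; since it commutes with the terms [t k l], it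
     carries [u0] to [u], so membership in [M] transfers. *)
  have [g [c [g_inj c0 g_sim gv]]] := similarity_of_ON_bases o nd v0ON vON.
  apply: (limg_theta g_inj g_sim nd _ Mu0) => l.
  rewrite uE u0E; apply: (limg_leval g_inj c0 g_sim) => -[i j] /=.
  rewrite f f0; have gi (i' : 'I_d) : g v0`_i' = v`_i'.
    by rewrite -gv (nth_map 0) ?size_tuple.
  by case: ifP => _; rewrite limg_line ?linearB /= !gi.
apply: definable_exists => k; apply: definable_and; first exact: definable_const.
apply: definable_and.
  by apply: definable_orthonormal_frame => // i j; exists (a k i j).
apply: definable_forall => l; apply: definable_eq; first by exists (LVar l).
(* Substituting the terms [a k i j] for the variables of [t k l] yields a term in [u], by induction
   on the outer term. *)
suff hs s : term_definable form
    (fun u : 'I_n -> {vspace V} => leval form (fun ij => leval form u (a k ij.1 ij.2)) s).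
  exact: hs.
elim: s => [ij||s1 IH1 s2 IH2|s IHs] /=.
- by exists (a k ij.1 ij.2).
- exact: term_definable0.
- exact: term_definableD.
- exact: term_definable_perp.
Qed.
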